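(* Let $m,r\ge1$ be integers, let $A(t)=\sum_{n\ge0}A_n\frac{t^n}{n!}$ be a formal power series with real coefficients and $A_0\neq0$, and let ${}_{{}_LH^{(m,r)}}A_n(x,y,z)$ $(n\ge0)$ be the associated Laguerre-Gould Hopper based Appell polynomials. Define real numbers $\beta_n$ by $$\beta_0=\frac1{A_0},\qquad \beta_n=-\frac1{A_0}\left(\sum_{k=1}^{n}\binom nk A_k\,\beta_{n-k}\right),\quad n=1,2,3,\ldots$$ Then ${}_{{}_LH^{(m,r)}}A_0(x,y,z)=\frac{1}{\beta_0}$, and for every $n\ge1$ $${}_{{}_LH^{(m,r)}}A_n(x,y,z)=\frac{(-1)^n}{(\beta_0)^{n+1}}\begin{vmatrix} 1 & {}_LH_1^{(m,r)}(x,y,z) & {}_LH_2^{(m,r)}(x,y,z) & \cdots & {}_LH_{n-1}^{(m,r)}(x,y,z) & {}_LH_n^{(m,r)}(x,y,z)\\ \beta_0 & \beta_1 & \beta_2 & \cdots & \beta_{n-1} & \beta_n\\ 0 & \beta_0 & \binom21\beta_1 & \cdots & \binom{n-1}1\beta_{n-2} & \binom n1\beta_{n-1}\\ 0 & 0 & \beta_0 & \cdots & \binom{n-1}2\beta_{n-3} & \binom n2\beta_{n-2}\\ \vdots & \vdots & \vdots & & \vdots & \vdots\\ 0 & 0 & 0 & \cdots & \beta_0 & \binom n{n-1}\beta_1 \end{vmatrix}.$$ Explicitly, the matrix is $(n+1)\times(n+1)$ with columns indexed by $j=0,\ldots,n$; its first row has entries ${}_LH_j^{(m,r)}(x,y,z)$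 (with ${}_LH_0^{(m,r)}=1$), and for $i=0,\ldots,n-1$ its $(i+2)$-nd row has entries $\binom ji\beta_{j-i}$ for $j\ge i$ and $0$ for $j<i$.
   Context: $C_0(x)=\sum_{k\ge0}\frac{(-1)^kx^k}{(k!)^2}$ is the Bessel-Tricomi function of order zero. The Laguerre-Gould Hopper polynomials ${}_LH_n^{(m,r)}(x,y,z)$ are defined by the formal generating function $$C_0(-xt^m)\exp(yt+zt^r)=\sum_{n=0}^\infty{}_LH_n^{(m,r)}(x,y,z)\frac{t^n}{n!},$$ and the Laguerre-Gould Hopper based Appell polynomials ${}_{{}_LH^{(m,r)}}A_n(x,y,z)$ associated with $A(t)$ are defined by $$A(t)\,C_0(-xt^m)\exp(yt+zt^r)=\sum_{n=0}^{\infty}{}_{{}_LH^{(m,r)}}A_n(x,y,z)\frac{t^n}{n!}.$$ *)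

(* Defs.v *)
From HB Require Import structures.
From mathcomp Require Import all_boot all_order all_algebra.
From mathcomp Require Import reals.

Set Implicit Arguments.
Unset Strict Implicit.
Unset Printing Implicit Defensive.

Import Order.TTheory GRing.Theory Num.Theory.
Local Open Scope ring_scope.

(* A formal power series in t is represented by its sequence of coefficients:
   [f n] is the coefficient of t^n. *)
Definition fps (R : realType) := nat -> R.

Section FormalPowerSeries.
Variable R : realType.
Implicit Types (f g u : fps R) (a : nat -> R).

Definition fps_one : fps R := fun n => (n == 0%N)%:R.

Definition fps_monom (c : R) (d : nat) : fps R :=
  fun n => if n == d then c else 0.

Definition fps_add f g : fps R := fun n => f n + g n.

Definition fps_mul f g : fps R := fun n => \sum_(k < n.+1) f k * g (n - k)%N.

Definition fps_pow f (k : nat) : fps R := iter k (fps_mul f) fps_one.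

(* The substitution f(u(t)) = \sum_k f_k u(t)^k, for u with u_0 = 0: then u^k
   has no term of degree < k, so only the k <= n contribute to t^n.  It is
   meaningless when u_0 != 0. *)
Definition fps_comp f u : fps R := fun n => \sum_(k < n.+1) f k * fps_pow u k n.

(* \sum_n a_n t^n / n! *)
Definition egf a : fps R := fun n => a n / n`!%:R.

(* The sequence a such that f(t) = \sum_n a_n t^n / n! (see egf_coefK). *)
Definition egf_coef f : nat -> R := fun n => n`!%:R * f n.

Lemma egf_coefK f : egf (egf_coef f) =1 f.
Proof.
by move=> n; rewrite /egf /egf_coef mulrC mulKf // pnatr_eq0 -lt0n fact_gt0.
Qed.

Definition fps_exp : fps R := fun k => (k`!%:R)^-1.

(* The Bessel-Tricomi function of order zero. *)
Definition fps_C0 : fps R := fun k => (-1) ^+ k / k`!%:R ^+ 2.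

(* C_0(-x t^m) exp(y t + z t^r); the substitutions require m, r >= 1. *)
Definition LGH_gen (m r : nat) (x y z : R) : fps R :=
  fps_mul (fps_comp fps_C0 (fps_monom (- x) m))
          (fps_comp fps_exp (fps_add (fps_monom y 1) (fps_monom z r))).

(* Laguerre-Gould Hopper polynomials. *)
Definition LGH (m r n : nat) (x y z : R) : R :=
  egf_coef (LGH_gen m r x y z) n.

(* Laguerre-Gould Hopper based Appell polynomials associated with
   A(t) = \sum_n A_n t^n / n!. *)
Definition LGHAppell (A : nat -> R) (m r n : nat) (x y z : R) : R :=
  egf_coef (fps_mul (egf A) (LGH_gen m r x y z)) n.

(* Row i.+1 has entries 'C(j, i) beta_(j - i) for i <= j. *)
Definition LGHAppell_mx (beta : nat -> R) (m r n : nat) (x y z : R) :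
    'M[R]_n.+1 :=
  \matrix_(i < n.+1, j < n.+1)
    match val i with
    | 0%N => LGH m r j x y z
    | i'.+1 => if (i' <= j)%N then 'C(j, i')%:R * beta (j - i')%N else 0
    end.

End FormalPowerSeries.

(* Main.v *)
(** Write [H] and [a] for the exponential generating functions of the
    Laguerre-Gould Hopper and of the based Appell polynomials, so that
    [a = A H].  The recurrence for [beta] says that its generating function is
    [1 / A], hence [H = beta a]: the first row of the determinant is the linear
    combination with coefficients [a_0, ..., a_n] of the rows of the triangular
    matrix [T = ('C(j, i) beta_(j - i))_(i, j)], whose other rows are copied
    one position lower.  So the matrix is [P T], where [P] is a companion-like
    matrix of determinant [(-1)^n a_n], and [\det T = beta_0^(n + 1)]. *)

Require Import Defs.
From HB Require Import structures.
From mathcomp Require Import all_boot all_order all_algebra.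
From mathcomp Require Import reals.

Set Implicit Arguments.
Unset Strict Implicit.
Unset Printing Implicit Defensive.

Import Order.TTheory GRing.Theory Num.Theory.
Local Open Scope ring_scope.

Section FormalPowerSeries.
Variable R : realType.
Implicit Types (f g h : fps R) (a b : nat -> R).

Lemma eq_fps_mul f f' g g' : f =1 f' -> g =1 g' -> fps_mul f g =1 fps_mul f' g'.
Proof. by move=> ff' gg' n; apply: eq_bigr => k _; rewrite ff' gg'. Qed.

(** Coefficient [n] only sees terms of degree at most [n], so truncation to polynomials loses
    nothing; the ring laws are inherited from [{poly R}] this way. *)
Lemma fps_mulE f g N n : (n < N)%N ->
  fps_mul f g n = (\poly_(i < N) f i * \poly_(i < N) g i)`_n.
Proof.
move=> nN; rewrite coefM; apply: eq_bigr => k _.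
by rewrite !coef_poly !(leq_ltn_trans _ nN) // ?leq_subr // -ltnS.
Qed.

Lemma fps_mulC f g : fps_mul f g =1 fps_mul g f.
Proof. by move=> n; rewrite !(fps_mulE _ _ (ltnSn n)) mulrC. Qed.

Lemma fps_mulA f g h : fps_mul f (fps_mul g h) =1 fps_mul (fps_mul f g) h.
Proof.
move=> n; pose T u := \poly_(i < n.+1) (u i : R).
transitivity ((T f * (T g * T h))`_n).
  rewrite coefM; apply: eq_bigr => k _.
  by rewrite coef_poly ltn_ord (@fps_mulE _ _ n.+1) // ltnS leq_subr.
rewrite mulrA coefM; apply: eq_bigr => k _.
by rewrite coef_poly ltnS leq_subr (@fps_mulE _ _ n.+1).
Qed.

Lemma fps_mul1 f : fps_mul (@fps_one R) f =1 f.
Proof.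
move=> n; rewrite /fps_mul big_ord_recl /fps_one eqxx mul1r subn0.
by rewrite big1 ?addr0 // => i _; rewrite mul0r.
Qed.

Lemma egf_mul a b :
  fps_mul (egf a) (egf b)
    =1 egf (fun n => \sum_(k < n.+1) 'C(n, k)%:R * a k * b (n - k)%N).
Proof.
move=> n; rewrite /egf mulr_suml; apply: eq_bigr => k _.
have kn : (k <= n)%N by rewrite -ltnS.
have C0 : 'C(n, k)%:R != 0 :> R by rewrite pnatr_eq0 -lt0n bin_gt0.
(* Splitting n! as C(n,k) k! (n-k)! makes the binomial factor cancel. *)
rewrite -[in RHS](bin_fact kn) !natrM !invfM.
by rewrite mulrACA -(mulrA 'C(n, k)%:R) [RHS]mulrACA divff // mul1r.
Qed.

Lemma egf_inj a b : egf a =1 egf b -> a =1 b.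
Proof.
move=> ab n; move: (ab n); rewrite /egf => /mulIf; apply.
by rewrite invr_eq0 pnatr_eq0 -lt0n fact_gt0.
Qed.

Lemma egf_mul_inverse a b : a 0%N != 0 -> b 0%N = 1 / a 0%N ->
  (forall n, (1 <= n)%N -> b n = - (1 / a 0%N) *
     (\sum_(1 <= k < n.+1) 'C(n, k)%:R * a k * b (n - k)%N)) ->
  fps_mul (egf b) (egf a) =1 @fps_one R.
Proof.
move=> a0 b0 bS n; rewrite fps_mulC egf_mul /egf /fps_one.
case: n => [|n]; first by rewrite big_ord1 bin0 mul1r b0 div1r divff ?invr1 ?mulr1.
rewrite (_ : \sum_(k < _) _ = 0) ?mul0r //.
rewrite -(big_mkord xpredT (fun k => 'C(n.+1, k)%:R * a k * b (n.+1 - k)%N)).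
(* The [k = 0] term [a 0 * b n.+1] is, by the recurrence, the opposite of the remaining sum. *)
rewrite big_ltn // bin0 mul1r subn0 bS // div1r mulNr mulrN mulVKf //.
by rewrite addNr.
Qed.

Lemma LGH_gen0 m r (x y z : R) : LGH_gen m r x y z 0%N = 1.
Proof.
rewrite /LGH_gen /fps_mul /fps_comp !big_ord1 /= /fps_C0 /fps_exp /fps_one.
by rewrite !fact0 !expr0 expr1n !invr1 !mulr1.
Qed.

Lemma LGH_sum A beta m r n (x y z : R) :
  fps_mul (egf beta) (egf A) =1 @fps_one R ->
  LGH m r n x y z =
    \sum_(k < n.+1) LGHAppell A m r k x y z * ('C(n, k)%:R * beta (n - k)%N).
Proof.
move=> betaA; pose H := LGH_gen m r x y z; pose a := egf_coef (fps_mul (egf A) H).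
pose b p := \sum_(k < p.+1) 'C(p, k)%:R * a k * beta (p - k)%N.
transitivity (b n).
  (* As series, the claim reads H = beta (A H), which follows from (beta A) H = H. *)
  apply: (@egf_inj (egf_coef H) b) => p.
  rewrite -egf_mul fps_mulC (eq_fps_mul (fun=> erefl) (egf_coefK _)) fps_mulA.
  by rewrite (eq_fps_mul betaA (fun=> erefl)) fps_mul1 egf_coefK.
by apply: eq_bigr => k _; rewrite mulrA [_ * 'C(_, _)%:R]mulrC.
Qed.

End FormalPowerSeries.

Section Determinants.
Variable R : comNzRingType.

Definition binomial_mx (b : nat -> R) n : 'M[R]_n.+1 :=
  \matrix_(i, j) if (i <= j)%N then 'C(j, i)%:R * b (j - i)%N else 0.

Lemma det_binomial_mx b n : \det (binomial_mx b n) = b 0%N ^+ n.+1.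
Proof.
rewrite -det_tr det_trig.
  under eq_bigr do rewrite !mxE leqnn binn subnn mul1r.
  by rewrite prodr_const card_ord.
by apply/is_trig_mxP => i j ij; rewrite !mxE leqNgt ij.
Qed.

(** The matrix P: below its first row, row i+1 is the i-th unit vector, so multiplying by P on the
    left moves rows down by one and drops the last. *)
Definition shift_mx (a : nat -> R) n : 'M[R]_n.+1 :=
  \matrix_(i, j) if val i is i'.+1 then (j == i' :> nat)%:R else a j.

Lemma det_shift_mx a n : \det (shift_mx a n) = (-1) ^+ n * a n.
Proof.
(* Row i+1 has its 1 in column i < n, so the last column contains only [a n], at the top; the
   complementary minor is the identity. *)
rewrite (expand_det_col _ ord_max) big_ord_recl big1 ?addr0 => [|i _].
  rewrite mxE /cofactor /= (_ : row' _ _ = 1%:M) ?det1 ?mulr1 1?mulrC //.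
  by apply/matrixP => i j; rewrite !mxE /= /bump leqNgt (ltn_ord j) eq_sym.
by rewrite mxE /= add0n gtn_eqF ?mul0r //; exact: ltn_ord i.
Qed.

Lemma mulmx_shift_binomial a b n :
  shift_mx a n *m binomial_mx b n =
  \matrix_(i, j) match val i with
    | 0%N => \sum_(k < j.+1) a k * ('C(j, k)%:R * b (j - k)%N)
    | i'.+1 => if (i' <= j)%N then 'C(j, i')%:R * b (j - i')%N else 0
    end.
Proof.
apply/matrixP => i j; rewrite !mxE.
case: i => [[|i] /= lt_i].
  rewrite (big_ord_widen n.+1 (fun k => a k * ('C(j, k)%:R * b (j - k)%N))) //.
  (* Terms with k > j vanish because the binomial matrix is upper triangular. *)
  rewrite [RHS]big_mkcond; apply: eq_bigr => k _; rewrite !mxE /= ltnS.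
  by case: ifP; rewrite ?mulr0.
have lt_i' : (i < n.+1)%N by apply: ltnW.
rewrite (bigD1 (Ordinal lt_i')) //= big1 ?addr0 => [|k ne_ki].
  by rewrite !mxE /= eqxx mul1r.
by rewrite !mxE /= -[i]/(val (Ordinal lt_i')) val_eqE (negPf ne_ki) mul0r.
Qed.

End Determinants.

Theorem mainTheorem7 (R : realType) (m r : nat) (hm : (1 <= m)%N)
    (hr : (1 <= r)%N) (A : nat -> R) (hA0 : A 0%N <> 0)
    (beta : nat -> R) (hbeta0 : beta 0%N = 1 / A 0%N)
    (hbeta : forall n : nat, (1 <= n)%N ->
       beta n = - (1 / A 0%N) *
         (\sum_(1 <= k < n.+1) 'C(n, k)%:R * A k * beta (n - k)%N))
    (x y z : R) :
  LGHAppell A m r 0 x y z = 1 / beta 0%N /\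
  (forall n : nat, (1 <= n)%N ->
     LGHAppell A m r n x y z =
       (-1) ^+ n / beta 0%N ^+ n.+1 * \det (LGHAppell_mx beta m r n x y z)).
Proof.
move/eqP: hA0 => A0.
have betaA := egf_mul_inverse A0 hbeta0 hbeta.
have beta0 : beta 0%N != 0 by rewrite hbeta0 div1r invr_eq0.
split=> [|n _].
  rewrite /LGHAppell /egf_coef /fps_mul big_ord1 LGH_gen0 /egf hbeta0 fact0.
  by rewrite mul1r mulr1 divr1 !div1r invrK mul1r.
pose a k := LGHAppell A m r k x y z.
have -> : LGHAppell_mx beta m r n x y z = shift_mx a n *m binomial_mx beta n.
  rewrite mulmx_shift_binomial; apply/matrixP => i j; rewrite !mxE.
  by case: (val i) => //; apply: (LGH_sum _ _ _ _ _ _ betaA).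
(* The powers of [beta 0] cancel, and the two signs (-1)^n multiply to 1. *)
rewrite det_mulmx det_shift_mx det_binomial_mx mulrACA.
by rewrite mulVf ?expf_neq0 // mulr1 mulrA -expr2 sqrr_sign mul1r.
Qed.
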